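(* Let $m \in \mathbb{N}_0$, let $N = \dim \Pi_m$, and let $X = \{x_1,\ldots,x_N\} \subset \Omega$ be $\Pi_m$-unisolvent. Suppose that $\Omega$ is bounded. Then $$\lim_{\ell \to \infty} w_\ell^* = w_{\mathrm{pol}} \quad \text{and} \quad e_\ell\big(Q_X(w_\ell^* )\big) = \mathcal{O}\big(\ell^{-(m+1)}\big) \quad \text{as } \ell \to \infty,$$ where $w_\ell^* \in \mathbb{R}^N$ are the worst-case optimal weights for the Gaussian kernel $K_\ell$ and $w_{\mathrm{pol}} \in \mathbb{R}^N$ are the weights of the unique polynomial cubature rule such that $Q_X(w_{\mathrm{pol}})[p] = L[p]$ for every $p \in \Pi_m$.
   Context: $\Omega$ is a subset of $\mathbb{R}^d$ with non-empty interior. $L \colon C(\Omega) \to \mathbb{R}$ is a positive linear functional ($L[f] \geq 0$ whenever $f \geq 0$) on the continuous real-valued functions on $\Omega$, satisfying $L[|p|] < \infty$ for every polynomial $p$. For a multi-index $\alpha \in \mathbb{N}_0^d$: $|\alpha| = \alpha_1 + \cdots + \alpha_d$ and $x^\alpha = x_1^{\alpha_1}\cdots x_d^{\alpha_d}$. $\Pi_m = \mathrm{span}\{x^\alpha : \alpha \in \mathbb{N}_0^d, |\alpha| \leq m\}$ is the space of $d$-variate polynomials of degree at most $m$. A set $X \subset \Omega$ of distinct points is $\Pi_m$-unisolvent if $\# X = \dim \Pi_m = \binom{m+d}{d}$ and the zero function is the only element of $\Pi_m$ vanishing on $X$. The Gaussian kernel with length-scale $\ell>0$ is $K_\ell(x,x')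 = \exp(-\|x-x'\|_2^2/(2\ell^2))$ on $\Omega \times \Omega$, and $\mathcal{H}(K_\ell) \subset C(\Omega)$ is its reproducing kernel Hilbert space. For $w = (w(1),\ldots,w(N)) \in \mathbb{R}^N$, the cubature rule is $Q_X(w)[f] = \sum_{n=1}^N w(n) f(x_n)$. Its worst-case error is $e_\ell(Q_X(w)) = \sup_{\|f\|_{\mathcal{H}(K_\ell)} \leq 1} |L[f] - \sum_{n=1}^N w(n) f(x_n)|$. The worst-case optimal weights are $w_\ell^* = \arg\min_{w \in \mathbb{R}^N} e_\ell(Q_X(w))$; they are unique and solve the linear system $\sum_{k=1}^N K_\ell(x_n,x_k) w_\ell^*(k) = L[K_\ell(\cdot,x_n)]$, $n=1,\ldots,N$. *)

(* Defs.v *)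
From HB Require Import structures.
From mathcomp Require Import all_boot all_order all_algebra.
From mathcomp Require Import all_classical all_reals all_analysis.

Set Implicit Arguments.
Unset Strict Implicit.
Unset Printing Implicit Defensive.

Import Order.TTheory GRing.Theory Num.Theory.
Import numFieldNormedType.Exports.

Local Open Scope classical_set_scope.
Local Open Scope ring_scope.

(* A set [Omega : set 'rV[R]_d] used as a type is the subtype of its elements,
   with the subspace topology; functions on Omega have type [Omega -> R]. *)

(* Makes the Landau notation [f =O_ +oo g] usable. *)
Canonical pinfty_filter_on (R : numFieldType) :=
  FilterType (pinfty_nbhs R) _.

Section defs.
Variable R : realType.

(* [L] is only constrained on continuous functions: its values elsewhere are
   junk and never used.  As it is real valued on all of C(Omega), the quantities
   L[|p|], for p a polynomial, are automatically finite. *)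
Definition positive_linear_functional (T : topologicalType)
    (L : (T -> R) -> R) : Prop :=
  (forall (a : R) (f g : T -> R), continuous f -> continuous g ->
     L (fun y => a * f y + g y) = a * L f + L g) /\
  (forall f : T -> R, continuous f -> (forall y, 0 <= f y) -> 0 <= L f).

Definition monomial (d : nat) (alpha : 'I_d -> nat) (y : 'rV[R]_d) : R :=
  \prod_(i < d) y ord0 i ^+ alpha i.

(* Every entry of a multi-index of degree at most m is at most m, so that the
   multi-indices of degree at most m are the elements of total degree at most m
   of the finite type below. *)
Definition poly_space (d m : nat) : set ('rV[R]_d -> R) :=
  [set p | exists c : {ffun 'I_d -> 'I_m.+1} -> R, p =
     fun y => \sum_(alpha : {ffun 'I_d -> 'I_m.+1}
                      | (\sum_(i < d) alpha i <= m)%N)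
                c alpha * monomial (fun i => alpha i) y].

Definition unisolvent (d m N : nat) (Omega : set 'rV[R]_d) (x : 'I_N -> Omega) :
    Prop :=
  [/\ injective x, N = 'C(m + d, d) &
      forall p, poly_space m p -> (forall n, p (set_val (x n)) = 0) ->
        p = cst 0].

Definition gauss_kernel (d : nat) (Omega : set 'rV[R]_d) (ell : R) (y z : Omega) : R :=
  expR (- (\sum_(i < d) (set_val y ord0 i - set_val z ord0 i) ^+ 2)
        / (2 * ell ^+ 2)).

Definition hnorm (T : Type) (ip : (T -> R) -> (T -> R) -> R) (f : T -> R) : R :=
  Num.sqrt (ip f f).

(* The set of functions [H], with the inner product [ip] (which is junk outside
   of [H]), is a Hilbert space of functions on [T] with reproducing kernel [K]. *)
Record is_rkhs (T : Type) (K : T -> T -> R) (H : set (T -> R))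
    (ip : (T -> R) -> (T -> R) -> R) : Prop := IsRkhs {
  rkhs0 : H (cst 0) ;
  rkhs_lin : forall (a : R) f g, H f -> H g -> H (fun t => a * f t + g t) ;
  rkhs_ip_lin : forall (a : R) f g h, H f -> H g -> H h ->
    ip (fun t => a * f t + g t) h = a * ip f h + ip g h ;
  rkhs_ip_sym : forall f g, H f -> H g -> ip f g = ip g f ;
  rkhs_ip_ge0 : forall f, H f -> 0 <= ip f f ;
  rkhs_ip_eq0 : forall f, H f -> ip f f = 0 -> f = cst 0 ;
  rkhs_complete : forall u : nat -> T -> R, (forall n, H (u n)) ->
    (forall e : R, 0 < e -> exists n0 : nat, forall p q : nat,
       (n0 <= p)%N -> (n0 <= q)%N -> hnorm ip (u p \- u q) < e) ->
    exists2 f, H f & hnorm ip (u n \- f) @[n --> \oo] --> (0 : R) ;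
  rkhs_kernel : forall t, H (K ^~ t) ;
  rkhs_reproducing : forall f t, H f -> ip f (K ^~ t) = f t }.

Definition cubature (T : Type) (N : nat) (x : 'I_N -> T) (w : 'rV[R]_N)
    (f : T -> R) : R :=
  \sum_(n < N) w ord0 n * f (x n).

(* For a reproducing kernel Hilbert space with a bounded continuous kernel and
   a positive linear functional on the continuous functions, the set below is
   bounded, so that [sup] is its supremum. *)
Definition worst_case_error (T : Type) (H : set (T -> R))
    (ip : (T -> R) -> (T -> R) -> R) (L : (T -> R) -> R)
    (N : nat) (x : 'I_N -> T) (w : 'rV[R]_N) : R :=
  sup [set `|L f - cubature x w f| | f in [set f | H f /\ hnorm ip f <= 1]].

Definition optimal_weights (T : Type) (H : set (T -> R))
    (ip : (T -> R) -> (T -> R) -> R) (L : (T -> R) -> R)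
    (N : nat) (x : 'I_N -> T) (w : 'rV[R]_N) : Prop :=
  forall v : 'rV[R]_N,
    worst_case_error H ip L x w <= worst_case_error H ip L x v.

Definition polynomially_exact (d m : nat) (Omega : set 'rV[R]_d)
    (L : (Omega -> R) -> R) (N : nat) (x : 'I_N -> Omega) (w : 'rV[R]_N) : Prop :=
  forall p, poly_space m p ->
    cubature x w (p \o set_val) = L (p \o set_val).

End defs.

(* Main.v *)
(* With damp y = exp (- |y|^2 / (2 ell^2)), the kernel is
   damp y * damp z * exp (<y, z> / ell^2), and <y, z>^j is the sum over words t
   of length j in the coordinates of y_t * z_t.  Hence every quadratic form of
   the kernel is a series, in powers of ell^-2, of sums of squares of moments.
   Upper bound: for the Lagrange basis (p_n), the moments of degree at most m of
   delta_y - sum_n p_n(y) delta_(x_n) vanish, so the weights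
   L (p_n damp) / damp (x_n) have error O(ell^-(m+1)), and so have the optimal
   ones.  Lower bound: moments of degree at most m determine the weights, so the
   smallest eigenvalue of the kernel matrix is at least c ell^(-2m).  Two weight
   vectors with error O(ell^-(m+1)) thus differ by O(1 / ell), and the explicit
   weights tend to L p_n, the polynomial ones. *)
Require Import Defs.
From mathcomp Require Import all_boot all_order all_algebra.
From mathcomp Require Import all_classical all_reals all_analysis.
From mathcomp Require Import ring.

Set Implicit Arguments.
Unset Strict Implicit.
Unset Printing Implicit Defensive.

Import Order.TTheory GRing.Theory Num.Theory.
Import numFieldNormedType.Exports.

Local Open Scope classical_set_scope.
Local Open Scope ring_scope.

(** * Monomials and Lagrange interpolation *)

(** Induction on the number of digits: the residue modulo [B] is the lowest digit, and the quotient
    carries the remaining ones. *)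
Lemma digits_inj (B d : nat) (a b : nat -> nat) :
  (forall i, a i < B)%N -> (forall i, b i < B)%N ->
  (\sum_(i < d) a i * B ^ i = \sum_(i < d) b i * B ^ i)%N ->
  forall i, (i < d)%N -> a i = b i.
Proof.
elim: d a b => [//|d IH] a b aB bB.
have shift (c : nat -> nat) : (\sum_(i < d.+1) c i * B ^ i =
    (\sum_(i < d) c i.+1 * B ^ i) * B + c 0)%N.
  rewrite big_ord_recl expn0 muln1 addnC big_distrl /=; congr addn.
  by apply: eq_bigr => i _; rewrite /bump /= add1n expnSr mulnA.
rewrite !shift => E.
have B0 : (0 < B)%N by exact: leq_ltn_trans (aB 0%N).
have E0 : a 0%N = b 0%N.
  by have := congr1 (modn^~ B) E; rewrite /= !modnMDl !modn_small.
have E1 : (\sum_(i < d) a i.+1 * B ^ i = \sum_(i < d) b i.+1 * B ^ i)%N.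
  by have := congr1 (divn^~ B) E; rewrite /= !divnMDl // !divn_small // !addn0.
case=> [|i] // id; apply: (IH (a \o succn) (b \o succn)) => // j /=.
  exact: aB.
exact: bB.
Qed.

Lemma poly0_nat_roots (R : numDomainType) (p : {poly R}) :
  (forall n : nat, p.[n%:R] = 0) -> p = 0.
Proof.
move=> p0; apply/eqP; apply/negPn/negP => /max_poly_roots.
move=> /(_ [seq i%:R | i <- iota 0 (size p)]).
rewrite size_map size_iota ltnn => F; suff: false by [].
apply: F; first by apply/allP => _ /mapP[i _ ->]; rewrite /root p0.
rewrite map_inj_uniq ?iota_uniq// => i j /eqP.
by rewrite eqr_nat => /eqP.
Qed.

Definition peval (R : realType) (d m : nat) (c : {ffun 'I_d -> 'I_m.+1} -> R)
    (y : 'rV[R]_d) : R :=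
  \sum_(alpha : {ffun 'I_d -> 'I_m.+1} | (\sum_(i < d) alpha i <= m)%N)
    c alpha * monomial (fun i => alpha i) y.

Lemma peval_poly (R : realType) (d m : nat) (c : {ffun 'I_d -> 'I_m.+1} -> R) :
  poly_space m (peval c).
Proof. by exists c. Qed.

Lemma multiindex_code_inj (d m : nat) :
  injective (fun a : {ffun 'I_d -> 'I_m.+1} => \sum_(i < d) a i * m.+1 ^ i)%N.
Proof.
(* [inord] needs an inhabited ordinal type, so dimension 0 is split off; [ext] then turns a
   multi-index into a digit sequence on [nat]. *)
case: d => [|d] a b /= kab; first by apply/ffunP => -[].
pose ext (a : {ffun 'I_d.+1 -> 'I_m.+1}) (i : nat) : nat := a (inord i).
apply/ffunP => i; apply: val_inj.
have := @digits_inj m.+1 d.+1 (ext a) (ext b) _ _ _ i (ltn_ord i).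
rewrite /ext inord_val; apply=> [j|j|] //.
by under eq_bigr do rewrite inord_val; under [RHS]eq_bigr do rewrite inord_val.
Qed.

(* Kronecker substitution: evaluating at (t^(B^0), ..., t^(B^(d-1))) with
   B = m + 1 sends distinct monomials to distinct powers of t. *)
Lemma monomials_free (R : realType) (d m : nat)
    (c : {ffun 'I_d -> 'I_m.+1} -> R) :
  (forall y, peval c y = 0) ->
  forall alpha : {ffun 'I_d -> 'I_m.+1},
    (\sum_(i < d) alpha i <= m)%N -> c alpha = 0.
Proof.
move=> c0 alpha am.
pose k (a : {ffun 'I_d -> 'I_m.+1}) := (\sum_(i < d) a i * m.+1 ^ i)%N.
pose p : {poly R} := \sum_(a : {ffun 'I_d -> 'I_m.+1}
   | (\sum_(i < d) a i <= m)%N) c a *: 'X^(k a).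
have p0 : p = 0.
  apply: poly0_nat_roots => n; rewrite -(c0 (\row_i n%:R ^+ (m.+1 ^ i))).
  rewrite /peval horner_sum; apply: eq_bigr => a _.
  rewrite hornerZ hornerXn /monomial expr_sum; congr (_ * _); apply: eq_bigr => i _.
  by rewrite mxE -exprM mulnC.
have k_inj : injective k by exact: multiindex_code_inj.
have := congr1 (fun q : {poly R} => q`_(k alpha)) p0.
rewrite coef0 coef_sum (bigD1 alpha)//= big1 ?addr0 => [|a /andP[_ aa]].
  by rewrite coefZ coefXn eqxx mulr1.
by rewrite coefZ coefXn (inj_eq k_inj) eq_sym (negPf aa) mulr0.
Qed.

(** The known count concerns tuples of bounded sum; the injection [f] carries it over to finite
    functions. *)
Lemma card_multiindices (d m : nat) :
  #|[set alpha : {ffun 'I_d -> 'I_m.+1} | (\sum_(i < d) alpha i <= m)%N]%SET|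
    = 'C(m + d, d).
Proof.
rewrite addnC -card_partial_ord_partitions.
pose f (t : d.-tuple 'I_m.+1) := [ffun i => tnth t i].
have f_inj : injective f.
  move=> s t /ffunP st; apply: eq_from_tnth => i.
  by have := st i; rewrite !ffunE.
rewrite -(card_imset _ f_inj); apply: eq_card => alpha.
rewrite inE; apply/idP/imsetP => [am|[t]].
  exists [tuple alpha i | i < d].
    rewrite inE big_tuple; apply: leq_trans am.
    by apply: leq_sum => i _; rewrite tnth_mktuple.
  by apply/ffunP => i; rewrite ffunE tnth_mktuple.
rewrite inE big_tuple => tm ->; apply: leq_trans tm.
by apply: leq_sum => i _; rewrite ffunE.
Qed.

(** The matrix [A] of monomials at the nodes is square by the node count. A vector of its left
    kernel gives a polynomial vanishing at the nodes, which is zero by unisolvence and has zero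
    coefficients by [monomials_free]. The rows of a left inverse of [A] are then the Lagrange
    coefficients. *)
Lemma lagrange_basis (R : realType) (d m N : nat) (Omega : set 'rV[R]_d)
    (x : 'I_N -> Omega) : unisolvent m x ->
  exists c : 'I_N -> {ffun 'I_d -> 'I_m.+1} -> R,
    forall n k, peval (c n) (set_val (x k)) = (n == k)%:R.
Proof.
case=> _ NE uni.
pose S := [set alpha : {ffun 'I_d -> 'I_m.+1} | (\sum_(i < d) alpha i <= m)%N]%SET.
have SN : #|S| = N by rewrite NE -card_multiindices.
(* Only the default element that [enum_rank_in] requires. *)
pose alpha0 : {ffun 'I_d -> 'I_m.+1} := [ffun=> ord0].
have S0 : alpha0 \in S by rewrite inE big1// => i _; rewrite ffunE.
pose coef (u : 'rV[R]_#|S|) alpha := u ord0 (enum_rank_in S0 alpha).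
pose A : 'M[R]_(#|S|, N) :=
  \matrix_(s, n) monomial (fun i => (enum_val s : {ffun 'I_d -> 'I_m.+1}) i) (set_val (x n)).
have evalE u n : peval (coef u) (set_val (x n)) = (u *m A) ord0 n.
  rewrite mxE /peval.
  rewrite (eq_bigl (fun a => a \in S)) => [|a]; last by rewrite inE.
  rewrite big_enum_val; apply: eq_bigr => s _.
  by rewrite mxE /coef enum_valK_in.
have freeA : row_free A.
  apply: inj_row_free => u uA0; apply/rowP => s; rewrite [RHS]mxE.
  have u0 : peval (coef u) = cst 0.
    by apply: uni (peval_poly _) _ => n; rewrite evalE uA0 mxE.
  have := @monomials_free _ _ _ (coef u) (fun y => congr1 (@^~ y) u0) (enum_val s).
  rewrite /coef enum_valK_in; apply.
  by have := enum_valP s; rewrite inE.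
have fullA : row_full A by rewrite /row_full -[X in _ == X]SN.
case/row_fullP: fullA => B BA.
exists (fun n => coef (row n B)) => n k.
by rewrite evalE -row_mul BA !mxE.
Qed.

(** * Quadratic forms of the exponential kernel *)

Definition dotv (R : realType) (d : nat) (y z : 'rV[R]_d) : R :=
  \sum_(i < d) y ord0 i * z ord0 i.

(** The entries of the [j]-fold tensor power of [y]. Unlike monomials, they expand powers of the
    inner product without multinomial coefficients. *)
Definition word (R : realType) (d j : nat) (t : {ffun 'I_j -> 'I_d})
    (y : 'rV[R]_d) : R :=
  \prod_(i < j) y ord0 (t i).

Definition quad (R : realType) (I : finType) (v : I -> R) (k : I -> I -> R) : R :=
  \sum_a \sum_b v a * v b * k a b.

Lemma dotv_exp (R : realType) (d j : nat) (y z : 'rV[R]_d) :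
  dotv y z ^+ j = \sum_(t : {ffun 'I_j -> 'I_d}) word t y * word t z.
Proof.
rewrite -[in LHS](card_ord j) -prodr_const bigA_distr_bigA.
by apply: eq_bigr => t _; rewrite big_split.
Qed.

Lemma quad_dotv_exp (R : realType) (d j : nat) (I : finType) (v : I -> R)
    (p : I -> 'rV[R]_d) :
  quad v (fun a b => dotv (p a) (p b) ^+ j) =
  \sum_(t : {ffun 'I_j -> 'I_d}) (\sum_a v a * word t (p a)) ^+ 2.
Proof.
rewrite /quad; under eq_bigr do under eq_bigr do rewrite dotv_exp mulr_sumr.
under eq_bigr do rewrite exchange_big /=.
rewrite exchange_big /=; apply: eq_bigr => t _.
rewrite expr2 mulr_suml; apply: eq_bigr => a _.
rewrite mulr_sumr; apply: eq_bigr => b _; ring.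
Qed.

Lemma word_monomial (R : realType) (d j : nat) (t : {ffun 'I_j -> 'I_d})
    (y : 'rV[R]_d) : word t y = monomial (fun i => #|[pred k | t k == i]|) y.
Proof.
rewrite /word /monomial (partition_big t xpredT) //=; apply: eq_bigr => i _.
rewrite -prodr_const; apply: eq_big => [k|k /eqP ->] //.
Qed.

(** Counting the letters of [t] by value gives a multi-index of total degree [j], so each count is
    at most [m]. *)
Lemma word_poly (R : realType) (d j m : nat) (t : {ffun 'I_j -> 'I_d}) :
  (j <= m)%N -> poly_space m (word t : 'rV[R]_d -> R).
Proof.
move=> jm.
pose n i := #|[pred k | t k == i]|.
have nsum : (\sum_i n i = j)%N.
  rewrite -[RHS](card_ord j) -sum1_card (partition_big t xpredT) //=.
  by apply: eq_bigr => i _; rewrite sum1_card.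
have nm i : (n i < m.+1)%N.
  by rewrite ltnS (leq_trans _ jm)// -nsum (bigD1 i)//= leq_addr.
pose alpha : {ffun 'I_d -> 'I_m.+1} := [ffun i => Ordinal (nm i)].
exists (fun b => (b == alpha)%:R); apply/funext => y.
rewrite (bigD1 alpha) /=; last first.
  by under eq_bigr do rewrite ffunE; rewrite nsum.
rewrite eqxx mul1r big1 ?addr0 => [|b /andP[_ /negPf ->]]; last by rewrite mul0r.
by rewrite word_monomial /monomial; apply: eq_bigr => i _; rewrite ffunE.
Qed.

Lemma monomial_word (R : realType) (d : nat) (alpha : 'I_d -> nat) :
  exists t : {ffun 'I_(\sum_(i < d) alpha i) -> 'I_d},
    forall y : 'rV[R]_d, monomial alpha y = word t y.
Proof.
(* The sorted word, in which each letter [i] occurs [alpha i] times. *)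
pose s := flatten [seq nseq (alpha i) i | i <- index_enum 'I_d].
have ss : size s == (\sum_(i < d) alpha i)%N.
  rewrite size_flatten /shape -map_comp sumnE big_map.
  by apply/eqP; apply: eq_bigr => i _ /=; rewrite size_nseq.
exists [ffun i => tnth (Tuple ss) i] => y.
rewrite /word; under eq_bigr do rewrite ffunE.
rewrite -(big_tuple _ _ (Tuple ss) xpredT (fun i => y ord0 i)) /= big_flatten big_map.
by apply: eq_bigr => i _; rewrite big_nseq iter_mulr_1.
Qed.

(** * The exponential series and two-sided bounds for the quadratic form *)

Lemma exp_partial_sums_cvg (R : realType) (s : R) :
  \sum_(j < n) s ^+ j / j`!%:R @[n --> \oo] --> expR s.
Proof.
rewrite (_ : (fun n : nat => _) = series (exp_coeff s)).
  exact: is_cvg_series_exp_coeff.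
by apply/funext => n; rewrite /series /= big_mkord.
Qed.

Lemma exp_partial_sum_le (R : realType) (s : R) (n : nat) :
  0 <= s -> \sum_(j < n) s ^+ j / j`!%:R <= expR s.
Proof.
move=> s0; apply: (cvgr_to_ge (@exp_partial_sums_cvg _ s)).
exists n => // k /= nk; rewrite -(subnKC nk) big_split_ord /= lerDl.
by apply: sumr_ge0 => j _; rewrite divr_ge0 ?exprn_ge0.
Qed.

(** Factoring [s ^+ m] out of the tail leaves a series dominated by that of [expR |s|], because the
    factorial of [m + j] is at least that of [j]. The bound holds for partial sums and passes to the
    limit. *)
Lemma expR_taylor_bound (R : realType) (s : R) (m : nat) :
  `|expR s - \sum_(j < m) s ^+ j / j`!%:R| <= `|s| ^+ m * expR `|s|.
Proof.
have cvgl : `|\sum_(j < n + m) s ^+ j / j`!%:R - \sum_(j < m) s ^+ j / j`!%:R|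
    @[n --> \oo] --> `|expR s - \sum_(j < m) s ^+ j / j`!%:R|.
  apply: cvg_norm; apply: cvgB; last exact: cvg_cst.
  have := @exp_partial_sums_cvg R s.
  by rewrite -(cvg_shiftn m).
apply: (cvgr_to_le cvgl); apply: nearW => n.
rewrite addnC big_split_ord /= addrAC subrr add0r.
apply: le_trans (ler_norm_sum _ _ _) _.
apply: (@le_trans _ _ (`|s| ^+ m * \sum_(j < n) `|s| ^+ j / j`!%:R)); last first.
  by rewrite ler_wpM2l ?exprn_ge0 // exp_partial_sum_le.
rewrite mulr_sumr; apply: ler_sum => j _.
rewrite normrM normrX normfV normr_nat exprD -mulrA.
rewrite ler_wpM2l ?exprn_ge0 // ler_wpM2l ?exprn_ge0 //.
by rewrite lef_pV2 ?posrE ?ltr0n ?fact_gt0// ler_nat leq_fact // leq_addl.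
Qed.

Lemma cvg_quad (R : realType) (I : finType) (v : I -> R)
    (k : nat -> I -> I -> R) (l : I -> I -> R) :
  (forall a b, k n a b @[n --> \oo] --> l a b) ->
  quad v (k n) @[n --> \oo] --> quad v l.
Proof.
move=> kl; apply: cvg_big => [|a _]; first exact: add_continuous.
apply: cvg_big => [|b _]; first exact: add_continuous.
by apply: cvgM (kl a b); exact: cvg_cst.
Qed.

Lemma quad_dotv_series (R : realType) (d n : nat) (I : finType) (v : I -> R)
    (p : I -> 'rV[R]_d) (c : R) :
  quad v (fun a b => \sum_(j < n) (c * dotv (p a) (p b)) ^+ j / j`!%:R) =
  \sum_(j < n) c ^+ j / j`!%:R *
    \sum_(t : {ffun 'I_j -> 'I_d}) (\sum_a v a * word t (p a)) ^+ 2.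
Proof.
under [RHS]eq_bigr do rewrite -quad_dotv_exp /quad mulr_sumr.
rewrite [RHS]exchange_big /=; apply: eq_bigr => a _.
under [RHS]eq_bigr do rewrite mulr_sumr.
rewrite [RHS]exchange_big /=; apply: eq_bigr => b _.
rewrite mulr_sumr; apply: eq_bigr => j _.
by rewrite exprMn; ring.
Qed.

(** All terms of the series are nonnegative, so every partial sum reaching degree [j] dominates the
    single square belonging to [t]. *)
Lemma quad_exp_ge (R : realType) (d j : nat) (I : finType) (v : I -> R)
    (p : I -> 'rV[R]_d) (c : R) (t : {ffun 'I_j -> 'I_d}) : 0 <= c ->
  c ^+ j / j`!%:R * (\sum_a v a * word t (p a)) ^+ 2 <=
  quad v (fun a b => expR (c * dotv (p a) (p b))).
Proof.
move=> c0.
have cvgq := @cvg_quad _ _ v _ _ (fun a b =>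
  @exp_partial_sums_cvg R (c * dotv (p a) (p b))).
apply: (cvgr_to_ge cvgq); exists j.+1 => // n /= jn.
rewrite quad_dotv_series (bigD1 (Ordinal jn)) //=.
rewrite ler_wpDr //; last first.
  rewrite ler_wpM2l ?divr_ge0 ?exprn_ge0 //.
  rewrite [leRHS](bigD1 t) //= lerDl; apply: sumr_ge0 => u _; exact: sqr_ge0.
apply: sumr_ge0 => i _; rewrite mulr_ge0 ?divr_ge0 ?exprn_ge0 //.
by apply: sumr_ge0 => u _; exact: sqr_ge0.
Qed.

(** Since [v] annihilates polynomials of degree at most [m], subtracting the Taylor polynomial from
    the kernel leaves the form unchanged; the remainder is then estimated entry by entry. *)
Lemma quad_exp_le (R : realType) (d m : nat) (I : finType) (v : I -> R)
    (p : I -> 'rV[R]_d) (c D : R) :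
  (forall q, poly_space m q -> \sum_a v a * q (p a) = 0) ->
  (forall a b, `|dotv (p a) (p b)| <= D) -> 0 <= c -> c <= 1 ->
  quad v (fun a b => expR (c * dotv (p a) (p b))) <=
  c ^+ m.+1 * ((\sum_a `|v a|) ^+ 2 * (D ^+ m.+1 * expR D)).
Proof.
move=> v0 pD c0 c1.
(* The sign of [D] follows from the bound only when [I] has an element, hence the argument [a]. *)
have D0 (a : I) : 0 <= D by exact: le_trans (pD a a).
have -> : quad v (fun a b => expR (c * dotv (p a) (p b))) =
    quad v (fun a b => expR (c * dotv (p a) (p b)) -
      \sum_(j < m.+1) (c * dotv (p a) (p b)) ^+ j / j`!%:R).
  apply/esym; rewrite -[RHS]subr0; rewrite -[X in _ = _ - X](_ :
    quad v (fun a b => \sum_(j < m.+1) (c * dotv (p a) (p b)) ^+ j / j`!%:R) = 0).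
    rewrite /quad -sumrB; apply: eq_bigr => a _; rewrite -sumrB.
    by apply: eq_bigr => b _; rewrite mulrBr.
  rewrite quad_dotv_series big1 // => j _; rewrite big1 ?mulr0 // => t _.
  by rewrite v0 ?expr0n //; apply: word_poly; rewrite -ltnS.
rewrite [leRHS](_ : _ = \sum_a \sum_b
    `|v a| * `|v b| * (c ^+ m.+1 * (D ^+ m.+1 * expR D))); last first.
  rewrite expr2 mulrCA -mulrA mulr_suml; apply: eq_bigr => a _.
  by rewrite mulr_suml mulr_sumr; apply: eq_bigr => b _; ring.
apply: ler_sum => a _; apply: ler_sum => b _.
apply: le_trans (ler_norm _) _; rewrite !normrM ler_wpM2l ?mulr_ge0 //.
apply: le_trans (expR_taylor_bound _ _) _.
have cD : `|c * dotv (p a) (p b)| <= c * D.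
  by rewrite normrM ger0_norm // ler_wpM2l.
rewrite mulrA -exprMn; apply: ler_pM; rewrite ?exprn_ge0 ?expR_ge0 //.
  by rewrite lerXn2r // ?nnegrE // mulr_ge0 // (D0 a).
by rewrite ler_expR (le_trans cD) // -[leRHS]mul1r ler_wpM2r // (D0 a).
Qed.

(** * Positive functionals and reproducing kernel Hilbert spaces *)

Section positive_functionals.
Context (R : realType) (T : topologicalType) (L : (T -> R) -> R).
Hypothesis L_pos : positive_linear_functional L.

Lemma plf0 : L (cst 0) = 0.
Proof.
have /(_ 1 (cst 0) (cst 0)) := L_pos.1.
rewrite (_ : (fun y => _) = cst 0); last first.
  by apply/funext => y /=; rewrite mulr0 addr0.
move=> /(_ (fun=> cvg_cst _) (fun=> cvg_cst _)); rewrite mul1r => /eqP.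
by rewrite -subr_eq subrr eq_sym => /eqP.
Qed.

(** Continuity and value are proved in one induction, as linearity of [L] is available only on
    continuous functions. *)
Lemma plf_lincomb (I : Type) (s : seq I) (v : I -> R) (f : I -> T -> R) :
  (forall i, continuous (f i)) ->
  continuous (fun y => \sum_(i <- s) v i * f i y) /\
  L (fun y => \sum_(i <- s) v i * f i y) = \sum_(i <- s) v i * L (f i).
Proof.
move=> fc; elim: s => [|i s [IHc IH]].
  under eq_fun do rewrite big_nil; rewrite big_nil.
  by split=> [y|]; [exact: cvg_cst | exact: plf0].
under eq_fun do rewrite big_cons; rewrite big_cons.
split; last by rewrite L_pos.1 // IH.
by move=> y; apply: cvgD (IHc y); apply: cvgM (fc i y); exact: cvg_cst.
Qed.

Lemma plfZ (a : R) (f : T -> R) : continuous f -> L (fun y => a * f y) = a * L f.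
Proof.
move=> fc; have [_] := plf_lincomb [:: tt] (fun=> a) (fun _ : unit => fc).
by rewrite big_seq1; under eq_fun do rewrite big_seq1.
Qed.

Lemma plf_norm_le (f : T -> R) (C : R) :
  continuous f -> (forall y, `|f y| <= C) -> `|L f| <= C * L (cst 1).
Proof.
move=> fc fC.
have c1 (b : R) : continuous (cst b : T -> R) by move=> y; exact: cvg_cst.
have cC : continuous (fun y : T => C * cst 1 y).
  by move=> y; apply: cvgM; exact: cvg_cst.
have Lc (a : R) : L (fun y => a * f y + C * cst 1 y) = a * L f + C * L (cst 1).
  by rewrite L_pos.1 // plfZ.
(* Positivity is applied to [C + f] and [C - f], that is, with [a] equal to 1 and to -1. *)
have pos (a : R) : `|a| = 1 -> 0 <= a * L f + C * L (cst 1).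
  move=> a1; rewrite -Lc; apply: L_pos.2.
    move=> y; apply: cvgD (cC y); apply: cvgM (fc y); exact: cvg_cst.
  move=> y /=; rewrite mulr1 -lerBlDl sub0r.
  apply: le_trans (fC y); rewrite -[leRHS]mul1r -a1 -normrM -normrN.
  exact: ler_norm.
rewrite ler_norml; apply/andP; split.
  by have := pos 1 (normr1 _); rewrite mul1r -lerBlDr sub0r.
have := pos (- 1); rewrite normrN1 mulN1r addrC subr_ge0; exact.
Qed.

End positive_functionals.

Section rkhs_facts.
Context (R : realType) (T : Type) (K : T -> T -> R) (H : set (T -> R)).
Context (ip : (T -> R) -> (T -> R) -> R).
Hypothesis HK : is_rkhs K H ip.

Lemma rkhs_ip0 f : H f -> ip (cst 0) f = 0.
Proof.
move=> Hf; have := rkhs_ip_lin HK 1 (rkhs0 HK) (rkhs0 HK) Hf.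
rewrite (_ : (fun t => _) = cst 0); last first.
  by apply/funext => y /=; rewrite mulr0 addr0.
by move=> /eqP; rewrite mul1r -subr_eq subrr eq_sym => /eqP.
Qed.

Lemma rkhs_kernel_comb (I : Type) (s : seq I) (v : I -> R) (p : I -> T) :
  H (fun t => \sum_(a <- s) v a * K t (p a)).
Proof.
elim: s => [|a s IH]; first by under eq_fun do rewrite big_nil; exact: rkhs0 HK.
by under eq_fun do rewrite big_cons; exact: (rkhs_lin HK _ (rkhs_kernel HK _)).
Qed.

Lemma rkhs_ip_kernel_comb (I : Type) (s : seq I) (v : I -> R) (p : I -> T) f :
  H f -> ip (fun t => \sum_(a <- s) v a * K t (p a)) f = \sum_(a <- s) v a * f (p a).
Proof.
move=> Hf; elim: s => [|a s IH].
  by under eq_fun do rewrite big_nil; rewrite big_nil; exact: rkhs_ip0.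
under eq_fun do rewrite big_cons; rewrite big_cons.
rewrite (rkhs_ip_lin HK _ (rkhs_kernel HK _) (rkhs_kernel_comb _ _ _) Hf) IH.
by rewrite (rkhs_ip_sym HK) ?(rkhs_reproducing HK) //; exact: rkhs_kernel HK _.
Qed.

Lemma rkhs_ip_kernel_combs (I : finType) (v : I -> R) (p : I -> T) :
  let g t := \sum_a v a * K t (p a) in
  ip g g = quad v (fun a b => K (p a) (p b)).
Proof.
move=> g; rewrite rkhs_ip_kernel_comb; last exact: rkhs_kernel_comb.
apply: eq_bigr => a _; rewrite mulr_sumr; apply: eq_bigr => b _; ring.
Qed.

Lemma rkhs_cauchy_schwarz f g : H f -> H g ->
  ip f g ^+ 2 <= ip f f * ip g g.
Proof.
move=> Hf Hg.
have [g0|gn0] := eqVneq (ip g g) 0.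
  rewrite (rkhs_ip_eq0 HK Hg g0) (rkhs_ip_sym HK Hf (rkhs0 HK)) !rkhs_ip0 //.
    by rewrite expr0n mulr0.
  exact: rkhs0 HK.
have g_gt0 : 0 < ip g g by rewrite lt_def gn0 (rkhs_ip_ge0 HK).
(* The component of [f] orthogonal to [g]; the inequality says that its squared norm is
   nonnegative. *)
pose u t := (- (ip f g / ip g g)) * g t + f t.
have Hu : H u by exact: (rkhs_lin HK).
have uE h : H h -> ip u h = - (ip f g / ip g g) * ip g h + ip f h.
  by move=> Hh; rewrite (rkhs_ip_lin HK).
have := rkhs_ip_ge0 HK Hu.
rewrite uE // (rkhs_ip_sym HK Hg Hu) (rkhs_ip_sym HK Hf Hu) !uE //.
rewrite (rkhs_ip_sym HK Hg Hf) => u0.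
rewrite -ler_pdivrMr //; rewrite -subr_ge0; move: u0; congr (0 <= _).
by field.
Qed.

(** A combination of point evaluations is represented by the same combination of kernel sections,
    whose squared norm is the quadratic form; Cauchy-Schwarz concludes. *)
Lemma rkhs_eval_le (I : finType) (v : I -> R) (p : I -> T) f : H f ->
  (\sum_a v a * f (p a)) ^+ 2 <= ip f f * quad v (fun a b => K (p a) (p b)).
Proof.
move=> Hf; rewrite -(rkhs_ip_kernel_comb _ _ _ Hf) -rkhs_ip_kernel_combs mulrC.
by apply: rkhs_cauchy_schwarz => //; exact: rkhs_kernel_comb.
Qed.

Lemma hnorm0 : hnorm ip (cst 0) = 0.
Proof. by rewrite /hnorm rkhs_ip0 ?sqrtr0 //; exact: rkhs0 HK. Qed.

Lemma hnormK f : H f -> hnorm ip f ^+ 2 = ip f f.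
Proof. by move=> Hf; rewrite sqr_sqrtr // (rkhs_ip_ge0 HK). Qed.

Lemma rkhs_point_le f t : H f -> K t t = 1 -> `|f t| <= hnorm ip f.
Proof.
move=> Hf Kt; rewrite -ler_sqr ?nnegrE ?sqrtr_ge0 //.
rewrite hnormK // real_normK ?num_real //.
have := rkhs_eval_le (fun _ : unit => 1) (fun=> t) Hf.
by rewrite /quad !big_const !card_unit /= !addr0 Kt !mul1r mulr1.
Qed.

Lemma rkhs_dist_le f s t : H f ->
  K s s = 1 -> K t t = 1 -> K s t = K t s ->
  (f s - f t) ^+ 2 <= ip f f * (2 * (1 - K t s)).
Proof.
move=> Hf Ks Kt Kst.
have := rkhs_eval_le (fun b : bool => if b then 1 else - 1)
  (fun b => if b then s else t) Hf.
rewrite /quad !big_bool Ks Kt Kst /= mul1r mulN1r; congr (_ <= _ * _).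
ring.
Qed.

End rkhs_facts.

(** * The worst-case error as a supremum over the unit ball *)

Section worst_case_error_bounds.
Context (R : realType) (T : topologicalType) (K : T -> T -> R).
Context (H : set (T -> R)) (ip : (T -> R) -> (T -> R) -> R).
Context (L : (T -> R) -> R) (N : nat) (x : 'I_N -> T).
Hypothesis HK : is_rkhs K H ip.
Hypothesis K1 : forall t, K t t = 1.
Hypothesis Hcont : forall f, H f -> continuous f.
Hypothesis L_pos : positive_linear_functional L.

Lemma worst_case_error_le (w : 'rV[R]_N) (C : R) :
  (forall f, H f -> hnorm ip f <= 1 -> `|L f - cubature x w f| <= C) ->
  worst_case_error H ip L x w <= C.
Proof.
move=> le_C; apply: ge_sup => [|_ [f [Hf f1] <-]]; last exact: le_C.
exists `|L (cst 0) - cubature x w (cst 0)|; exists (cst 0) => //; split.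
  exact: rkhs0 HK.
by rewrite (hnorm0 HK).
Qed.

(** Makes [sup] a true supremum instead of a default value: a kernel equal to 1 on the diagonal
    bounds the unit ball pointwise by 1. *)
Lemma has_ubound_errors (w : 'rV[R]_N) :
  has_ubound [set `|L f - cubature x w f| | f in [set f | H f /\ hnorm ip f <= 1]].
Proof.
exists (L (cst 1) + \sum_n `|w ord0 n|) => _ [f [Hf f1] <-].
have f_le1 t : `|f t| <= 1 by exact: le_trans (rkhs_point_le HK Hf (K1 t)) f1.
apply: le_trans (ler_normB _ _) _; apply: lerD.
  by rewrite -[leRHS]mul1r; apply: plf_norm_le => //; exact: Hcont.
apply: le_trans (ler_norm_sum _ _ _) _; apply: ler_sum => n _.
by rewrite normrM ler_piMr.
Qed.

Lemma worst_case_error_ge0 (w : 'rV[R]_N) : 0 <= worst_case_error H ip L x w.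
Proof.
apply: le_trans (normr_ge0 (L (cst 0) - cubature x w (cst 0))) _.
apply: ub_le_sup; first exact: has_ubound_errors.
by exists (cst 0) => //; split; [exact: rkhs0 HK | rewrite (hnorm0 HK)].
Qed.

Lemma le_worst_case_error (w : 'rV[R]_N) f : H f ->
  `|L f - cubature x w f| <= worst_case_error H ip L x w * hnorm ip f.
Proof.
move=> Hf.
have [f0|fn0] := eqVneq (hnorm ip f) 0.
  have /(rkhs_ip_eq0 HK Hf) -> : ip f f = 0 by rewrite -(hnormK HK) // f0 expr0n.
  rewrite plf0 // /cubature big1 ?subrr ?normr0 => [|n _]; last by rewrite mulr0.
  rewrite mulr_ge0 ?sqrtr_ge0 //; exact: worst_case_error_ge0.
have f_gt0 : 0 < hnorm ip f by rewrite lt_def fn0 sqrtr_ge0.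
pose g t := (hnorm ip f)^-1 * f t.
(* Adding the zero function brings [g] to the shape expected by [rkhs_lin] and [rkhs_ip_lin]. *)
have gE0 : g = fun t => (hnorm ip f)^-1 * f t + cst 0 t.
  by apply/funext => t /=; rewrite addr0.
have Hg : H g.
  rewrite gE0; exact: (rkhs_lin HK _ Hf (rkhs0 HK)).
rewrite -ler_pdivrMr //; apply: ub_le_sup; first exact: has_ubound_errors.
exists g; last first.
  rewrite plfZ //; last exact: Hcont.
  rewrite (_ : cubature x w g = (hnorm ip f)^-1 * cubature x w f); last first.
    by rewrite /cubature mulr_sumr; apply: eq_bigr => n _; rewrite mulrCA.
  by rewrite -mulrBr normrM normfV (gtr0_norm f_gt0) mulrC.
split=> //.
have gE h : H h -> ip g h = (hnorm ip f)^-1 * ip f h.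
  move=> Hh; rewrite gE0 (rkhs_ip_lin HK _ Hf (rkhs0 HK) Hh).
  by rewrite (rkhs_ip0 HK Hh) addr0.
rewrite [hnorm ip g]/hnorm gE // (rkhs_ip_sym HK Hf Hg) gE // -(hnormK HK) //.
by rewrite expr2 mulKf // mulVf // sqrtr1.
Qed.

End worst_case_error_bounds.

(** * The Gaussian kernel on a bounded set *)

(** Used with [c = ell ^- 2]. *)
Definition damp (R : realType) (d : nat) (c : R) (y : 'rV[R]_d) : R :=
  expR (- (c / 2 * dotv y y)).

Lemma dotvv_ge0 (R : realType) (d : nat) (y : 'rV[R]_d) : 0 <= dotv y y.
Proof. by apply: sumr_ge0 => i _; rewrite -expr2 sqr_ge0. Qed.

Lemma damp_le1 (R : realType) (d : nat) (c : R) (y : 'rV[R]_d) :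
  0 <= c -> damp c y <= 1.
Proof.
move=> c0; rewrite expR_le1 oppr_le0 mulr_ge0 ?dotvv_ge0 //.
by rewrite divr_ge0.
Qed.

Lemma gauss_kernel_damp (R : realType) (d : nat) (Omega : set 'rV[R]_d) (ell : R)
    (y z : Omega) : ell != 0 ->
  gauss_kernel ell y z = damp (ell ^- 2) (set_val y) * damp (ell ^- 2) (set_val z)
    * expR (ell ^- 2 * dotv (set_val y) (set_val z)).
Proof.
move=> ell0; rewrite /gauss_kernel /damp -!expRD; congr expR.
have -> : \sum_(i < d) (set_val y ord0 i - set_val z ord0 i) ^+ 2 =
    dotv (set_val y) (set_val y) - 2 * dotv (set_val y) (set_val z)
    + dotv (set_val z) (set_val z).
  rewrite /dotv mulr_sumr -sumrB -big_split /=; apply: eq_bigr => i _; ring.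
by field.
Qed.

Lemma gauss_kernelxx (R : realType) (d : nat) (Omega : set 'rV[R]_d) (ell : R)
    (y : Omega) : gauss_kernel ell y y = 1.
Proof.
by rewrite /gauss_kernel big1 ?oppr0 ?mul0r ?expR0 // => i _; rewrite subrr expr0n.
Qed.

Lemma gauss_kernelC (R : realType) (d : nat) (Omega : set 'rV[R]_d) (ell : R)
    (y z : Omega) : gauss_kernel ell y z = gauss_kernel ell z y.
Proof.
rewrite /gauss_kernel.
by under eq_bigr do rewrite -sqrrN opprB.
Qed.

(** * Continuity of kernels, polynomials and functions of the Hilbert space *)

Section continuous_real_functions.
Context (R : realType) (T : topologicalType).
Implicit Types f g : T -> R.

Lemma continuous_const (a : R) : continuous (fun _ : T => a).
Proof. by move=> y; exact: cvg_cst. Qed.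

Lemma continuous_add f g : continuous f -> continuous g ->
  continuous (fun y => f y + g y).
Proof. by move=> fc gc y; apply: cvgD; [exact: fc | exact: gc]. Qed.

Lemma continuous_mul f g : continuous f -> continuous g ->
  continuous (fun y => f y * g y).
Proof. by move=> fc gc y; apply: cvgM; [exact: fc | exact: gc]. Qed.

Lemma continuous_opp f : continuous f -> continuous (fun y => - f y).
Proof. by move=> fc y; apply: cvgN; exact: fc. Qed.

Lemma continuous_sum (I : Type) (s : seq I) (P : pred I) (f : I -> T -> R) :
  (forall i, continuous (f i)) -> continuous (fun y => \sum_(i <- s | P i) f i y).
Proof.
move=> fc y; apply: cvg_big => [|i _]; first exact: add_continuous.
exact: fc.
Qed.

Lemma continuous_prod (I : Type) (s : seq I) (P : pred I) (f : I -> T -> R) :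
  (forall i, continuous (f i)) -> continuous (fun y => \prod_(i <- s | P i) f i y).
Proof.
move=> fc y; apply: cvg_big => [|i _]; first exact: mul_continuous.
exact: fc.
Qed.

Lemma continuous_expn f (n : nat) :
  continuous f -> continuous (fun y => f y ^+ n).
Proof.
move=> fc y; apply: (@continuous_comp _ _ _ f (fun u => u ^+ n)); first exact: fc.
exact: exprn_continuous.
Qed.

Lemma continuous_exp f : continuous f -> continuous (fun y => expR (f y)).
Proof.
move=> fc y; apply: (@continuous_comp _ _ _ f expR); first exact: fc.
exact: continuous_expR.
Qed.

Lemma continuous_of_sq_dist_le f (k : T -> T -> R) :
  (forall t, continuous (k t)) -> (forall t, k t t = 0) ->
  (forall s t, (f t - f s) ^+ 2 <= k t s) -> continuous f.
Proof.
move=> kc k0 fk t; apply/cvgrPdist_le => e e0.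
have := kc t t; rewrite /continuous_at k0 => kct.
have e2 : 0 < e ^+ 2 by rewrite exprn_gt0.
near=> s.
have le_e : k t s <= e ^+ 2.
  by near: s; exact: (cvgr_le _ kct _ e2).
rewrite -ler_sqr ?nnegrE ?(ltW e0) // real_normK ?num_real //.
exact: le_trans (fk s t) le_e.
Unshelve. all: by end_near.
Qed.

End continuous_real_functions.

Section continuity.
Context (R : realType) (d : nat) (Omega : set 'rV[R]_d).

Lemma continuous_coord (i : 'I_d) : continuous (fun y : Omega => set_val y ord0 i).
Proof.
move=> y; apply: (@continuous_comp _ _ _ set_val (fun z : 'rV[R]_d => z ord0 i)).
  exact: initial_continuous.
exact: coord_continuous.
Qed.

Lemma continuous_peval (m : nat) (c : {ffun 'I_d -> 'I_m.+1} -> R) :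
  continuous (fun y : Omega => peval c (set_val y)).
Proof.
apply: continuous_sum => a; apply: continuous_mul; first exact: continuous_const.
apply: continuous_prod => i; apply: continuous_expn; exact: continuous_coord.
Qed.

Lemma continuous_damp (c : R) : continuous (fun y : Omega => damp c (set_val y)).
Proof.
apply: continuous_exp; apply: continuous_opp.
apply: continuous_mul; first exact: continuous_const.
by apply: continuous_sum => i; apply: continuous_mul; exact: continuous_coord.
Qed.

Lemma continuous_gauss_kernel (ell : R) (z : Omega) :
  continuous (gauss_kernel ell z).
Proof.
apply: continuous_exp; apply: continuous_mul; last exact: continuous_const.
apply: continuous_opp; apply: continuous_sum => i; apply: continuous_expn.
apply: continuous_add; first exact: continuous_const.
by apply: continuous_opp; exact: continuous_coord.
Qed.

(** Continuity comes from the reproducing property: the kernel sections at [s] and [t] are at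
    squared distance [2 * (1 - K t s)], which tends to 0 as [s] tends to [t]. *)
Lemma continuous_gauss_rkhs (ell : R) (H : set (Omega -> R))
    (ip : (Omega -> R) -> (Omega -> R) -> R) :
  is_rkhs (@gauss_kernel R d Omega ell) H ip ->
  forall f, H f -> continuous f.
Proof.
move=> HK f Hf.
apply: (@continuous_of_sq_dist_le _ _ _
    (fun t s => ip f f * (2 * (1 - gauss_kernel ell t s)))) => [t|t|s t].
- apply: continuous_mul; first exact: continuous_const.
  apply: continuous_mul; first exact: continuous_const.
  apply: continuous_add; first exact: continuous_const.
  by apply: continuous_opp; exact: continuous_gauss_kernel.
- by rewrite gauss_kernelxx subrr !mulr0.
- rewrite (gauss_kernelC ell t s).
  apply: (rkhs_dist_le HK Hf); rewrite ?gauss_kernelxx //.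
  exact: gauss_kernelC.
Qed.

End continuity.

Lemma bounded_coord (R : realType) (d : nat) (Omega : set 'rV[R]_d) :
  bounded_set Omega ->
  exists2 M : R, 0 <= M & forall (y : Omega) i, `|set_val y ord0 i| <= M.
Proof.
case=> M0 [_ HM]; exists (`|M0| + 1) => [|y i]; first by rewrite addr_ge0.
have M01 : M0 < `|M0| + 1 by apply: le_lt_trans (ler_norm _) _; rewrite ltrDl.
have Oy : Omega (set_val y) by exact: set_valP.
apply: le_trans (HM _ M01 _ Oy).
(* The norm of a row vector is the largest absolute value of its entries. *)
rewrite [leRHS](_ : _ = mx_norm (set_val y)) // mx_normrE.
exact: (le_bigmax _ (fun ij => `|set_val y ij.1 ij.2|) (ord0, i)).
Qed.

Lemma bounded_dotv (R : realType) (d : nat) (Omega : set 'rV[R]_d) :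
  bounded_set Omega ->
  exists2 D : R, 0 <= D &
    forall y z : Omega, `|dotv (set_val y) (set_val z)| <= D.
Proof.
case/bounded_coord => M M0 yM; exists (\sum_(i < d) M * M) => [|y z].
  by apply: sumr_ge0 => i _; rewrite mulr_ge0.
apply: le_trans (ler_norm_sum _ _ _) _; apply: ler_sum => i _.
by rewrite normrM ler_pM.
Qed.

Lemma bounded_peval (R : realType) (d m : nat) (Omega : set 'rV[R]_d)
    (c : {ffun 'I_d -> 'I_m.+1} -> R) : bounded_set Omega ->
  exists2 B : R, 0 <= B & forall y : Omega, `|peval c (set_val y)| <= B.
Proof.
case/bounded_coord => M M0 yM.
exists (\sum_(a : {ffun 'I_d -> 'I_m.+1} | (\sum_(i < d) a i <= m)%N)
  `|c a| * \prod_(i < d) M ^+ a i) => [|y].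
  by apply: sumr_ge0 => a _; rewrite mulr_ge0 // prodr_ge0 // => i _; exact: exprn_ge0.
apply: le_trans (ler_norm_sum _ _ _) _; apply: ler_sum => a _.
rewrite normrM ler_wpM2l // /monomial normr_prod; apply: ler_prod => i _.
by rewrite normr_ge0 normrX lerXn2r ?nnegrE.
Qed.

(** * Cubature with damped Lagrange polynomials *)

Section gaussian_cubature.
Context (R : realType) (d m N : nat) (Omega : set 'rV[R]_d).
Context (L : (Omega -> R) -> R) (x : 'I_N -> Omega).
Context (c : 'I_N -> {ffun 'I_d -> 'I_m.+1} -> R).
Hypothesis Omega_bounded : bounded_set Omega.
Hypothesis L_pos : positive_linear_functional L.
Hypothesis x_unisolvent : unisolvent m x.
Hypothesis lagrange : forall n k, peval (c n) (set_val (x k)) = (n == k)%:R.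

(** The difference of [q] and its interpolant is a polynomial of degree at most [m] vanishing at all
    nodes. *)
Lemma lagrange_interpolation q (y : 'rV[R]_d) : poly_space m q ->
  q y = \sum_n q (set_val (x n)) * peval (c n) y.
Proof.
move=> [b qb]; have {qb} qE z : q z = peval b z by rewrite qb.
have [_ _ /(_ (peval (fun a => b a - \sum_n q (set_val (x n)) * c n a)))] :=
  x_unisolvent.
have pE z : peval (fun a => b a - \sum_n q (set_val (x n)) * c n a) z =
    q z - \sum_n q (set_val (x n)) * peval (c n) z.
  rewrite [q z]qE /peval; under [X in _ = _ - X]eq_bigr do rewrite mulr_sumr.
  rewrite exchange_big -sumrB /=; apply: eq_bigr => a _.
  rewrite mulrBl mulr_suml; congr (_ - _); apply: eq_bigr => n _.
  by rewrite mulrA.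
move=> /(_ (peval_poly _)) p0.
have /(congr1 (@^~ y)) : peval (fun a => b a - \sum_n q (set_val (x n)) * c n a)
    = cst 0.
  apply: p0 => k; rewrite pE (bigD1 k) //= lagrange eqxx mulr1 big1 ?addr0 ?subrr //.
  by move=> n nk; rewrite lagrange (negPf nk) mulr0.
by rewrite /= pE => /eqP; rewrite subr_eq0 => /eqP.
Qed.

(* Up to the factor [1 / damp (x n)], these are the Lagrange polynomials times
   the Gaussian [damp]; the weights below integrate all products of [damp] and a
   polynomial of degree at most m exactly. *)
Definition damped_lagrange (ell : R) (n : 'I_N) (y : Omega) : R :=
  peval (c n) (set_val y) * (damp (ell ^- 2) (set_val y)
    / damp (ell ^- 2) (set_val (x n))).

Definition damped_weights (ell : R) : 'rV[R]_N :=
  \row_n L (damped_lagrange ell n).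

Lemma continuous_damped_lagrange ell n : continuous (damped_lagrange ell n).
Proof.
apply: continuous_mul; first exact: continuous_peval.
by apply: continuous_mul; [exact: continuous_damp | exact: continuous_const].
Qed.

Let invell_ge0 (ell : R) : 1 <= ell -> 0 <= ell ^- 2.
Proof. by move=> l1; rewrite invr_ge0 exprn_ge0 // (le_trans _ l1). Qed.

Let invell_le1 (ell : R) : 1 <= ell -> ell ^- 2 <= 1.
Proof.
move=> l1; rewrite invf_le1 ?exprn_ege1 // exprn_gt0 //.
exact: lt_le_trans ltr01 l1.
Qed.

(** The error at [y] combines evaluations at [y] and at the nodes. Pulling the damping factors out
    of the kernel turns its coefficients [v] into [nu], which annihilates polynomials of degree at
    most [m], so [quad_exp_le] applies. *)
Lemma damped_interpolation_error : exists2 C : R, 0 <= C &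
  forall (ell : R) H ip, 1 <= ell ->
    is_rkhs (@gauss_kernel R d Omega ell) H ip ->
    forall f (y : Omega), H f -> hnorm ip f <= 1 ->
    `|f y - \sum_n f (x n) * damped_lagrange ell n y| <= C * ell ^- m.+1.
Proof.
have [D D0 dotD] := bounded_dotv Omega_bounded.
have /choice[B /all_and2[B0 cB]] : forall n, exists B, 0 <= B /\
    forall y : Omega, `|peval (c n) (set_val y)| <= B.
  by move=> n; have [B ? ?] := bounded_peval (c n) Omega_bounded; exists B.
(* The constant of [quad_exp_le], with [1 + \sum_n B n] bounding the absolute sum of [nu]. *)
pose C2 := (1 + \sum_n B n) ^+ 2 * (D ^+ m.+1 * expR D).
have C2_ge0 : 0 <= C2.
  by rewrite mulr_ge0 ?sqr_ge0 // mulr_ge0 ?exprn_ge0 ?expR_ge0.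
exists (Num.sqrt C2) => [|ell H ip l1 HK f y Hf f1]; first exact: sqrtr_ge0.
have l_gt0 : 0 < ell by exact: lt_le_trans ltr01 l1.
pose p (a : unit + 'I_N) := if a is inr n then x n else y.
pose v (a : unit + 'I_N) := if a is inr n then - damped_lagrange ell n y else 1.
pose nu (a : unit + 'I_N) := if a is inr n then - peval (c n) (set_val y) else 1.
have sumE (F : unit + 'I_N -> R) : \sum_a F a = F (inl tt) + \sum_n F (inr n).
  by rewrite big_sumType (bigD1 tt) //= big1 ?addr0 // => -[].
have errE : f y - \sum_n f (x n) * damped_lagrange ell n y = \sum_a v a * f (p a).
  rewrite sumE /= mul1r -sumrN; congr (_ + _); apply: eq_bigr => n _.
  by rewrite mulNr mulrC.
rewrite errE -ler_sqr ?nnegrE //; last first.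
  by rewrite mulr_ge0 ?sqrtr_ge0 // invr_ge0 exprn_ge0 // ltW.
rewrite real_normK ?num_real // exprMn sqr_sqrtr // exprVn -exprM mulnC exprM -exprVn.
apply: le_trans (rkhs_eval_le HK v p Hf) _.
have quad0 := rkhs_ip_ge0 HK (rkhs_kernel_comb HK (index_enum _) v p).
rewrite (rkhs_ip_kernel_combs HK) in quad0.
have ipf1 : ip f f <= 1.
  by rewrite -(hnormK HK) // expr_le1 ?sqrtr_ge0.
apply: le_trans (ler_piMl quad0 ipf1) _.
have damp_gt0 z : 0 < damp (ell ^- 2) z :> R by exact: expR_gt0.
(* The quotient of damping factors in [damped_lagrange] is chosen to make this identity hold. *)
have vE a : v a * damp (ell ^- 2) (set_val (p a)) =
    damp (ell ^- 2) (set_val y) * nu a.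
  case: a => [_|n] /=; first by rewrite mulrC.
  by rewrite /damped_lagrange; field; rewrite gt_eqF.
have -> : quad v (fun a b => gauss_kernel ell (p a) (p b)) =
    damp (ell ^- 2) (set_val y) ^+ 2 * quad nu (fun a b =>
      expR (ell ^- 2 * dotv (set_val (p a)) (set_val (p b)))).
  rewrite /quad mulr_sumr; apply: eq_bigr => a _.
  rewrite mulr_sumr; apply: eq_bigr => b _.
  rewrite gauss_kernel_damp ?gt_eqF // [RHS]mulrA.
  rewrite (_ : _ ^+ 2 * (nu a * nu b) =
    (damp (ell ^- 2) (set_val y) * nu a) * (damp (ell ^- 2) (set_val y) * nu b)).
    by rewrite -!vE; ring.
  ring.
have qnu : quad nu (fun a b =>
      expR (ell ^- 2 * dotv (set_val (p a)) (set_val (p b)))) <= ell ^- 2 ^+ m.+1 * C2.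
  have nu0 q : poly_space m q -> \sum_a nu a * q (set_val (p a)) = 0.
    move=> qP; rewrite sumE /= mul1r [X in X + _](lagrange_interpolation _ qP).
    by rewrite -big_split /= big1 // => n _; rewrite mulNr mulrC subrr.
  apply: le_trans (quad_exp_le nu0 (fun a b => dotD _ _)
    (invell_ge0 l1) (invell_le1 l1)) _.
  rewrite ler_wpM2l ?exprn_ge0 ?invell_ge0 //.
  rewrite ler_wpM2r ?mulr_ge0 ?exprn_ge0 ?expR_ge0 //.
  have sum_nu : \sum_a `|nu a| <= 1 + \sum_n B n.
    rewrite sumE normr1 lerD2l; apply: ler_sum => n _; rewrite normrN; exact: cB.
  by rewrite lerXn2r // nnegrE ?(le_trans _ sum_nu) // sumr_ge0.
rewrite [leRHS]mulrC; apply: le_trans (ler_wpM2l (sqr_ge0 _) qnu) _.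
rewrite ler_piMl //; first by rewrite mulr_ge0 // exprn_ge0 // invell_ge0.
by rewrite expr_le1 ?damp_le1 ?invell_ge0 // ltW.
Qed.

(** The cubature error is [L] of the interpolation error, which is bounded uniformly in [y]. *)
Lemma damped_weights_error : exists2 C : R, 0 <= C &
  forall (ell : R) H ip, 1 <= ell ->
    is_rkhs (@gauss_kernel R d Omega ell) H ip ->
    worst_case_error H ip L x (damped_weights ell) <= C * ell ^- m.+1.
Proof.
have [C C0 errC] := damped_interpolation_error.
have L1 : 0 <= L (cst 1) by apply: L_pos.2 => [|y] //; exact: continuous_const.
exists (C * L (cst 1)) => [|ell H ip l1 HK]; first exact: mulr_ge0.
apply: (worst_case_error_le HK) => f Hf f1.
have fc : continuous f by exact: continuous_gauss_rkhs HK _ Hf.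
have [sc Ls] := plf_lincomb L_pos (index_enum 'I_N) (fun n => f (x n))
  (@continuous_damped_lagrange ell).
have -> : L f - cubature x (damped_weights ell) f =
    L (fun y => f y - \sum_n f (x n) * damped_lagrange ell n y).
  rewrite (_ : (fun y => _) = (fun y => -1 *
    (\sum_n f (x n) * damped_lagrange ell n y) + f y)); last first.
    by apply/funext => y; rewrite mulN1r addrC.
  rewrite L_pos.1 // Ls mulN1r [RHS]addrC; congr (_ - _).
  by apply: eq_bigr => n _; rewrite mxE mulrC.
rewrite mulrAC; apply: plf_norm_le => // [|y]; last exact: (errC _ _ _ l1 HK).
by apply: continuous_add => //; exact: continuous_opp.
Qed.

(** The exponent [s] of the quotient is of order [ell ^- 2], and [|expR s - 1|] is at most
    [|s| * expR |s|]; the weaker rate [1 / ell] suffices for the limit. *)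
Lemma damp_ratio_bound : exists2 C : R, 0 <= C &
  forall (ell : R) (y z : Omega), 1 <= ell ->
    `|damp (ell ^- 2) (set_val y) / damp (ell ^- 2) (set_val z) - 1| <= C / ell.
Proof.
have [D D0 dotD] := bounded_dotv Omega_bounded.
exists (D * expR D) => [|ell y z l1]; first by rewrite mulr_ge0 ?expR_ge0.
have l_gt0 : 0 < ell by exact: lt_le_trans ltr01 l1.
rewrite /damp -expRB; set s := - _ - _.
have sD : `|s| <= ell ^- 2 * D.
  rewrite (_ : s = ell ^- 2 *
    ((dotv (set_val z) (set_val z) - dotv (set_val y) (set_val y)) / 2)); last first.
    by rewrite /s; field; rewrite gt_eqF.
  rewrite normrM ger0_norm ?invell_ge0 // ler_wpM2l ?invell_ge0 //.
  rewrite normrM normfV [`|2|]ger0_norm // ler_pdivrMr //.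
  apply: le_trans (ler_normB _ _) _.
  by rewrite mulr_natr mulr2n lerD.
have := expR_taylor_bound s 1; rewrite big_ord1 expr0 fact0 divr1 expr1.
move=> /le_trans; apply.
rewrite mulrAC; apply: ler_pM; rewrite ?expR_ge0 //.
  apply: le_trans sD _; rewrite mulrC ler_wpM2l //.
  rewrite lef_pV2 ?posrE ?exprn_gt0 //.
  by rewrite expr2 ler_peMl // ltW.
by rewrite ler_expR (le_trans sD) // ler_piMl // invell_le1.
Qed.

Lemma damped_weights_lim (wpol : 'rV[R]_N) : polynomially_exact m L x wpol ->
  exists2 C : R, 0 <= C & forall (ell : R) n, 1 <= ell ->
    `|damped_weights ell ord0 n - wpol ord0 n| <= C / ell.
Proof.
move=> exact_wpol.
have [C C0 ratioC] := damp_ratio_bound.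
have /choice[B /all_and2[B0 cB]] : forall n, exists B, 0 <= B /\
    forall y : Omega, `|peval (c n) (set_val y)| <= B.
  by move=> n; have [B ? ?] := bounded_peval (c n) Omega_bounded; exists B.
have L1 : 0 <= L (cst 1) by apply: L_pos.2 => [|y] //; exact: continuous_const.
exists ((\sum_n B n) * C * L (cst 1)) => [|ell n l1].
  by rewrite !mulr_ge0 // sumr_ge0.
have l_gt0 : 0 < ell by exact: lt_le_trans ltr01 l1.
(* Exactness on the Lagrange polynomials determines the weights. *)
have -> : wpol ord0 n = L (fun y => peval (c n) (set_val y)).
  have <- := exact_wpol _ (peval_poly (c n)).
  rewrite /cubature (bigD1 n) //= lagrange eqxx mulr1 big1 ?addr0 // => k kn.
  by rewrite lagrange eq_sym (negPf kn) mulr0.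
have pc : continuous (fun y : Omega => peval (c n) (set_val y)).
  exact: continuous_peval.
have -> : damped_weights ell ord0 n - L (fun y => peval (c n) (set_val y)) =
    L (fun y => -1 * peval (c n) (set_val y) + damped_lagrange ell n y).
  rewrite L_pos.1 //; last exact: continuous_damped_lagrange.
  by rewrite mxE mulN1r addrC.
rewrite mulrAC; apply: plf_norm_le => // [|y].
  apply: continuous_add; last exact: continuous_damped_lagrange.
  by apply: continuous_mul => //; exact: continuous_const.
rewrite mulN1r addrC /damped_lagrange -{2}[peval _ _]mulr1 -mulrBr normrM -mulrA.
apply: ler_pM => //; last exact: ratioC.
by apply: le_trans (cB n y) _; rewrite (bigD1 n) //= lerDl sumr_ge0.
Qed.

(* The n-th entry of [damp * v] is a linear combination of its moments of degree
   at most m, and each squared moment of degree j is at most j! ell^(2j) times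
   the quadratic form. *)
Lemma gauss_quad_ge : exists2 C : R, 0 <= C &
  forall (ell : R) (v : 'I_N -> R) n, 1 <= ell ->
    `|v n| <= C * ell ^+ m *
      Num.sqrt (quad v (fun a b => gauss_kernel ell (x a) (x b))).
Proof.
have [D D0 dotD] := bounded_dotv Omega_bounded.
(* Summing over all [n] gives one constant valid for every entry. *)
pose S := \sum_n \sum_(a : {ffun 'I_d -> 'I_m.+1} | (\sum_(i < d) a i <= m)%N) `|c n a|.
exists (expR D * (S * Num.sqrt m`!%:R)) => [|ell v n l1].
  rewrite mulr_ge0 ?expR_ge0 // mulr_ge0 ?sqrtr_ge0 //.
  by apply: sumr_ge0 => n _; exact: sumr_ge0.
have l_gt0 : 0 < ell by exact: lt_le_trans ltr01 l1.
set q := quad v _.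
pose u k := v k * damp (ell ^- 2) (set_val (x k)).
have qE : q = quad u (fun a b =>
    expR (ell ^- 2 * dotv (set_val (x a)) (set_val (x b)))).
  apply: eq_bigr => a _; apply: eq_bigr => b _.
  by rewrite gauss_kernel_damp ?gt_eqF // /u; ring.
pose M := Num.sqrt m`!%:R * ell ^+ m * Num.sqrt q.
have M0 : 0 <= M by rewrite !mulr_ge0 ?sqrtr_ge0 // exprn_ge0 // ltW.
have q0 : 0 <= q.
  (* Any word yields a nonnegative lower bound; the word of the zero multi-index exists in every
     dimension. *)
  have [t _] := monomial_word R (fun _ : 'I_d => 0%N).
  have := quad_exp_ge u (fun k => set_val (x k)) t (invell_ge0 l1).
  rewrite -qE; apply: le_trans.
  by rewrite mulr_ge0 ?sqr_ge0 // divr_ge0 // exprn_ge0 // invell_ge0.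
have moment (a : {ffun 'I_d -> 'I_m.+1}) : (\sum_(i < d) a i <= m)%N ->
    `|\sum_k u k * monomial (fun i => a i) (set_val (x k))| <= M.
  move=> am; have [t tE] := monomial_word R (fun i => a i : nat).
  under eq_bigr do rewrite tE.
  rewrite -ler_sqr ?nnegrE // real_normK ?num_real //.
  rewrite !exprMn !sqr_sqrtr //.
  have := quad_exp_ge u (fun k => set_val (x k)) t (invell_ge0 l1).
  rewrite -qE; set j := (\sum_(i < d) a i)%N in t tE am *.
  set X := (\sum_k _) ^+ 2 => jX.
  have Ej : X = (j`!%:R * ell ^+ 2 ^+ j) * (ell ^- 2 ^+ j / j`!%:R * X).
    by rewrite exprVn; field; rewrite !gt_eqF ?exprn_gt0 ?ltr0n ?fact_gt0.
  rewrite Ej; apply: ler_pM => //.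
  - by rewrite mulr_ge0 // !exprn_ge0 // ltW.
  - by rewrite mulr_ge0 ?sqr_ge0 // divr_ge0 // exprn_ge0 // invell_ge0.
  apply: ler_pM => //; first by rewrite !exprn_ge0 // ltW.
    by rewrite ler_nat leq_fact.
  by rewrite -!exprM mulnC ler_weXn2l // leq_mul2r am orbT.
have uS : `|u n| <= S * M.
  (* Testing [u] against the [n]-th Lagrange polynomial isolates [u n] and writes it through
     moments. *)
  have -> : u n = \sum_(a : {ffun 'I_d -> 'I_m.+1} | (\sum_(i < d) a i <= m)%N)
      c n a * \sum_k u k * monomial (fun i => a i) (set_val (x k)).
    transitivity (\sum_k u k * peval (c n) (set_val (x k))).
      rewrite (bigD1 n) //= lagrange eqxx mulr1 big1 ?addr0 // => k kn.
      by rewrite lagrange eq_sym (negPf kn) mulr0.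
    under eq_bigr do rewrite mulr_sumr.
    rewrite exchange_big /=; apply: eq_bigr => a _.
    by rewrite mulr_sumr; apply: eq_bigr => k _; rewrite mulrCA.
  apply: le_trans (ler_norm_sum _ _ _) _.
  apply: (@le_trans _ _ ((\sum_(a : {ffun 'I_d -> 'I_m.+1}
      | (\sum_(i < d) a i <= m)%N) `|c n a|) * M)).
    rewrite mulr_suml; apply: ler_sum => a am.
    by rewrite normrM ler_wpM2l // moment.
  rewrite ler_wpM2r // /S (bigD1 n) //= lerDl sumr_ge0 // => k _.
  exact: sumr_ge0.
have -> : v n = u n * expR (ell ^- 2 / 2 * dotv (set_val (x n)) (set_val (x n))).
  by rewrite /u /damp -mulrA -expRD addNr expR0 mulr1.
rewrite normrM [leRHS](_ : _ = (S * M) * expR D); last by rewrite /M; ring.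
apply: ler_pM => //; rewrite ger0_norm ?expR_ge0 // ler_expR.
apply: le_trans (ler_norm _) _; rewrite normrM -[leRHS]mul1r; apply: ler_pM => //.
rewrite ger0_norm ?divr_ge0 ?invell_ge0 // ler_pdivrMr // mul1r.
by apply: le_trans (invell_le1 l1) _; rewrite ler1n.
Qed.

Lemma optimal_weights_dist (wopt : R -> 'rV[R]_N)
    (H : R -> set (Omega -> R)) (ip : R -> (Omega -> R) -> (Omega -> R) -> R) :
  (forall ell : R, 0 < ell -> is_rkhs (@gauss_kernel R d Omega ell) (H ell) (ip ell)) ->
  (forall ell : R, 0 < ell -> optimal_weights (H ell) (ip ell) L x (wopt ell)) ->
  exists2 C : R, 0 <= C & forall (ell : R) n, 1 <= ell ->
    `|wopt ell ord0 n - damped_weights ell ord0 n| <= C / ell.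
Proof.
move=> HK wopt_optimal.
have [A A0 errA] := damped_weights_error.
have [C C0 geC] := gauss_quad_ge.
(* The factor 2 accounts for two rules, optimal and damped, each with error at most
   [A * ell ^- m.+1]. *)
exists (C * (2 * A)) => [|ell n l1]; first by rewrite !mulr_ge0.
have l_gt0 : 0 < ell by exact: lt_le_trans ltr01 l1.
have HKl := HK _ l_gt0.
pose v k := wopt ell ord0 k - damped_weights ell ord0 k.
apply: le_trans (geC _ v n l1) _.
(* The representer g of the difference of the two rules satisfies
   |g|^2 = Q_wopt g - Q_damped g <= (sum of the two errors) * |g|. *)
pose g y := \sum_k v k * gauss_kernel ell y (x k).
have Hg : H ell g by exact: (rkhs_kernel_comb HKl).
have qE : quad v (fun a b => gauss_kernel ell (x a) (x b)) = ip ell g g.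
  by rewrite (rkhs_ip_kernel_combs HKl).
rewrite qE -[Num.sqrt _]/(hnorm (ip ell) g).
have hg : hnorm (ip ell) g <= 2 * (A * ell ^- m.+1).
  have cubE : cubature x (wopt ell) g - cubature x (damped_weights ell) g
      = hnorm (ip ell) g ^+ 2.
    rewrite (hnormK HKl) // (rkhs_ip_kernel_comb HKl) // /cubature -sumrB.
    by apply: eq_bigr => k _; rewrite mulrBl.
  have le_err w := le_worst_case_error x HKl (gauss_kernelxx ell)
    (continuous_gauss_rkhs HKl) L_pos w Hg.
  have [->|h0] := eqVneq (hnorm (ip ell) g) 0.
    by rewrite !mulr_ge0 // invr_ge0 exprn_ge0 // ltW.
  have h_gt0 : 0 < hnorm (ip ell) g by rewrite lt_def h0 sqrtr_ge0.
  rewrite -(ler_pM2r h_gt0) -expr2 -cubE.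
  have -> : cubature x (wopt ell) g - cubature x (damped_weights ell) g =
    (L g - cubature x (damped_weights ell) g) - (L g - cubature x (wopt ell) g).
    by ring.
  apply: le_trans (ler_norm _) _; apply: le_trans (ler_normB _ _) _.
  rewrite mulr_natl mulr2n mulrDl; apply: lerD.
    apply: le_trans (le_err _) _; rewrite ler_wpM2r ?sqrtr_ge0 //; exact: errA.
  apply: le_trans (le_err _) _; rewrite ler_wpM2r ?sqrtr_ge0 //.
  exact: le_trans (wopt_optimal _ l_gt0 _) (errA _ _ _ l1 HKl).
apply: le_trans (ler_wpM2l _ hg) _.
  by rewrite mulr_ge0 // exprn_ge0 // ltW.
(* The loss [ell ^+ m] against the gain [ell ^- m.+1] leaves exactly [1 / ell]. *)
rewrite le_eqVlt; apply/orP; left; apply/eqP.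
by rewrite exprS; field; rewrite gt_eqF //= expf_neq0 // gt_eqF.
Qed.

End gaussian_cubature.

Theorem corollary2p5 (R : realType) (d : nat) (Omega : set 'rV[R]_d)
    (Omega_int : Omega° !=set0) (Omega_bounded : bounded_set Omega)
    (L : (Omega -> R) -> R) (L_pos : positive_linear_functional L)
    (H : R -> set (Omega -> R)) (ip : R -> (Omega -> R) -> (Omega -> R) -> R)
    (H_rkhs : forall ell : R, 0 < ell ->
       is_rkhs (@gauss_kernel R d Omega ell) (H ell) (ip ell))
    (m N : nat) (x : 'I_N -> Omega) (x_unisolvent : unisolvent m x)
    (wopt : R -> 'rV[R]_N)
    (wopt_optimal : forall ell : R, 0 < ell ->
       optimal_weights (H ell) (ip ell) L x (wopt ell))
    (wpol : 'rV[R]_N) (wpol_exact : polynomially_exact m L x wpol) :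
  (wopt ell @[ell --> +oo] --> wpol) /\
  ((fun ell : R => worst_case_error (H ell) (ip ell) L x (wopt ell))
     =O_ +oo (fun ell : R => ell ^- m.+1)).
Proof.
have [c lagrange] := lagrange_basis x_unisolvent.
have [A A0 dist1] := optimal_weights_dist Omega_bounded L_pos x_unisolvent lagrange
  H_rkhs wopt_optimal.
have [B B0 dist2] := damped_weights_lim Omega_bounded L_pos lagrange wpol_exact.
have [C C0 errC] := damped_weights_error Omega_bounded L_pos x_unisolvent lagrange.
split.
  apply/cvg_ballP => e e0.
  (* Beyond this threshold the total distance [(A + B) / ell] is below [e]. *)
  have Ae : \forall ell \near +oo, (A + B) / e < ell.
    by apply: nbhs_pinfty_gt; exact: num_real.
  have l1 : \forall ell \near +oo, 1 <= ell :> R.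
    by apply: nbhs_pinfty_ge; exact: num_real.
  near=> ell; split=> // i n; rewrite ord1 /ball /= distrC.
  have ell1 : 1 <= ell by near: ell.
  have l_gt0 : 0 < ell by exact: lt_le_trans ltr01 ell1.
  apply: (@le_lt_trans _ _ ((A + B) / ell)); last first.
    by rewrite ltr_pdivrMr // mulrC -ltr_pdivrMr //; near: ell.
  rewrite -(subrKA (damped_weights L x c ell ord0 n)) mulrDl.
  by apply: le_trans (ler_normD _ _) _; apply: lerD; [exact: dist1 | exact: dist2].
apply/eqOP; near=> k; near=> ell.
have ell1 : 1 <= ell.
  by near: ell; apply: nbhs_pinfty_ge; exact: num_real.
have l_gt0 : 0 < ell by exact: lt_le_trans ltr01 ell1.
have HKl := H_rkhs _ l_gt0.
rewrite [X in X <= _]ger0_norm; last first.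
  exact: (worst_case_error_ge0 x HKl (gauss_kernelxx ell)
    (continuous_gauss_rkhs HKl) L_pos).
rewrite ger0_norm ?invr_ge0 ?exprn_ge0 // ?(ltW l_gt0) //.
(* Optimality transfers the rate of the explicit weights. *)
apply: le_trans (wopt_optimal _ l_gt0 (damped_weights L x c ell)) _.
apply: le_trans (errC _ _ _ ell1 HKl) _.
apply: ler_wpM2r; last by near: k; apply: nbhs_pinfty_ge; exact: num_real.
by rewrite invr_ge0 exprn_ge0 // ltW.
Unshelve. all: by end_near.
Qed.
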